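(* Consider the joint relaying scheme described in the context. For every relaying matrix $\mathbf{F}\in\mathbb{C}^{M_r\times M_r}$ satisfying the relay power constraint $\mathrm{tr}\left(\mathbf{F}(\mathbf{I}+\mathbf{R})\mathbf{F}^H\right)\le P_r$, the sum-rate satisfies both $$R_\Sigma(\mathbf{F})\le \log_2\left((1+s)\left(1+\frac{\lambda_{\max}(\mathbf{R})\|\mathbf{h}\|^2P_r}{1+\|\mathbf{h}\|^2P_r+\lambda_{\max}(\mathbf{R})}\right)\right)$$ and $$R_\Sigma(\mathbf{F})\le\log_2\left(1+s+\lambda_{\max}(\mathbf{R}+\mathbf{W})\right).$$
   Context: Data: integers $K,M_r\ge 1$; vectors $\mathbf{h}_r^{(k)}\in\mathbb{C}^{M_r}$, scalars $h_d^{(k)}\in\mathbb{C}$, powers $P^{(k)}\ge 0$, for $k=1,\dots,K$; a vector $\mathbf{h}\in\mathbb{C}^{M_r}$; relay power $P_r>0$. $\|\cdot\|$ is the Euclidean norm (absolute value for scalars), $(\cdot)^H$ the conjugate transpose, $\mathbf{I}$ the identity, $\lambda_{\max}$ the largest eigenvalue of a Hermitian matrix. For $\mathbf{F}\in\mathbb{C}^{M_r\times M_r}$ put $r=1+\mathbf{h}^H\mathbf{F}\mathbf{F}^H\mathbf{h}$ and $\mathbf{h}_{\mathrm{eff}}^{(k)}=[\,r^{-1/2}\mathbf{h}^H\mathbf{F}\mathbf{h}_r^{(k)},\ h_d^{(k)}]^T\in\mathbb{C}^2$. The sum-rate is $$R_\Sigma(\mathbf{F})=\log_2\det\left(\mathbf{I}+\sum_{k=1}^K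 P^{(k)}\mathbf{h}_{\mathrm{eff}}^{(k)}{\mathbf{h}_{\mathrm{eff}}^{(k)}}^H\right).$$ Moreover $s=\sum_{k=1}^K\|h_d^{(k)}\|^2P^{(k)}$, $\mathbf{R}=\sum_{k=1}^K P^{(k)}\mathbf{h}_r^{(k)}{\mathbf{h}_r^{(k)}}^H$, and $$\mathbf{W}=\tfrac12\sum_{j,k=1}^K P^{(j)}P^{(k)}\left(h_d^{(k)}\mathbf{h}_r^{(j)}-h_d^{(j)}\mathbf{h}_r^{(k)}\right)\left(h_d^{(k)}\mathbf{h}_r^{(j)}-h_d^{(j)}\mathbf{h}_r^{(k)}\right)^H.$$ *)

(* Defs.v *)
From mathcomp Require Export all_boot all_order all_algebra.
From mathcomp Require Export complex.
From mathcomp Require Export all_classical all_reals all_analysis.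

Set Implicit Arguments.
Unset Strict Implicit.
Unset Printing Implicit Defensive.

Import Order.TTheory GRing.Theory Num.Theory.

Local Open Scope ring_scope.
Local Open Scope complex_scope.
Local Open Scope classical_set_scope.
Local Open Scope sesquilinear_scope.

Definition log2 (R : realType) (x : R) : R := ln x / ln 2.

(* On R[i], `|z| is the modulus as a complex number, hence the projection to R. *)
Definition norm2 (R : realType) (m : nat) (v : 'cV[R[i]]_m) : R :=
  Num.sqrt (\sum_(i < m) complex.Re `|v i 0| ^+ 2).

(* For Hermitian A and m > 0, this supremum is attained and is the largest
   eigenvalue of A: see lambda_max_eigenvalue and eigenvalue_le_lambda_max. *)
Definition lambda_max (R : realType) (m : nat) (A : 'M[R[i]]_m) : R :=
  sup [set x : R | eigenvalue A x%:C].

Lemma seq_has_max (R : realType) (s : seq R) :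
  s != [::] -> exists2 l, l \in s & forall x, x \in s -> x <= l.
Proof.
elim: s => [//|a [|b s] IH] _.
  by exists a => [|x]; rewrite inE // => /eqP ->.
have [//|l ls lmax] := IH.
have [al|la] := leP a l.
  by exists l => [|x]; rewrite in_cons ?ls ?orbT// => /orP[/eqP->//|/lmax].
exists a => [|x]; rewrite in_cons ?eqxx// => /orP[/eqP->//|/lmax xl].
exact: le_trans xl (ltW la).
Qed.

Section LambdaMax.
Variables (R : realType) (m : nat) (A : 'M[R[i]]_m).
Hypotheses (m_gt0 : (0 < m)%N) (hermA : A ^t* = A).

Lemma hermitian_eigenvalue_real (a : R[i]) :
  eigenvalue A a -> (complex.Re a)%:C = a.
Proof using hermA.
case/eigenvalueP=> v vA v0; apply: RRe_real; apply/CrealP.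
have vvC : (v *m v ^t*) ^t* = v *m v ^t*.
  by rewrite trmx_mul map_mxM /= trmxCK.
have vAv : v *m A *m v ^t* = a *: (v *m v ^t*) by rewrite vA scalemxAl.
have vAvC : v *m A *m v ^t* = (v *m A *m v ^t*) ^t*.
  by rewrite !trmx_mul !map_mxM /= hermA trmxCK mulmxA.
have eq_a : (a^* - a) *: (v *m v ^t*) = 0.
  apply/eqP; rewrite scalerBl subr_eq0 -vAv vAvC vAv; apply/eqP.
  by rewrite linearZ /= map_mxZ vvC.
apply/eqP; rewrite -subr_eq0; move/eqP: eq_a; rewrite scaler_eq0 => /orP[//|].
move/eqP/matrixP/(_ 0 0); rewrite !mxE => s0.
case/negP: v0; apply/eqP/rowP => i; rewrite mxE.
have : \sum_j `|v 0 j| ^+ 2 = 0.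
  by rewrite -[RHS]s0; apply: eq_bigr => j _; rewrite !mxE normCK.
move/psumr_eq0P => /(_ (fun j _ => exprn_ge0 2 (normr_ge0 _)) i isT)/eqP.
by rewrite sqrf_eq0 normr_eq0 => /eqP.
Qed.

Lemma lambda_max_spec :
  eigenvalue A (lambda_max A)%:C /\
  forall x : R, eigenvalue A x%:C -> x <= lambda_max A.
Proof using m_gt0 hermA.
have [s charA] := closed_field_poly_normal (char_poly A).
have eigE a : eigenvalue A a = (a \in s).
  by rewrite eigenvalue_root_char charA (monicP (char_poly_monic A)) scale1r
             root_prod_XsubC.
have [a0 a0P] := eigenvalue_closed A m_gt0.
have [|l ls lmax'] := @seq_has_max R [seq complex.Re a | a <- s].
  by apply/eqP => s0; move: a0P; rewrite eigE; case: (s) s0.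
have lP : eigenvalue A l%:C.
  case/mapP: ls => a a_s ->; rewrite hermitian_eigenvalue_real ?eigE//.
have lmax (x : R) : eigenvalue A x%:C -> x <= l.
  by rewrite eigE => /(map_f (@complex.Re R)) /lmax'.
suff -> : lambda_max A = l by [].
apply/eqP; rewrite eq_le; apply/andP; split.
  by apply: ge_sup; [exists l | move=> x /lmax].
by apply: ub_le_sup => //; exists l => x /lmax.
Qed.

Lemma lambda_max_eigenvalue : eigenvalue A (lambda_max A)%:C.
Proof using m_gt0 hermA. by case: lambda_max_spec. Qed.

Lemma eigenvalue_le_lambda_max (a : R[i]) :
  eigenvalue A a -> a <= (lambda_max A)%:C.
Proof using m_gt0 hermA.
move=> aP; rewrite -(hermitian_eigenvalue_real aP) lecR.
by apply: (proj2 lambda_max_spec); rewrite hermitian_eigenvalue_real.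
Qed.

End LambdaMax.

Section JointRelaying.
Variables (R : realType) (K m : nat).
Variables (h_r : 'I_K -> 'cV[R[i]]_m) (h_d : 'I_K -> R[i]) (P : 'I_K -> R).

Definition direct_snr : R := \sum_(k < K) complex.Re `|h_d k| ^+ 2 * P k.

Definition relay_cov : 'M[R[i]]_m :=
  \sum_(k < K) (P k)%:C *: (h_r k *m (h_r k) ^t*).

Definition cross_vec (j k : 'I_K) : 'cV[R[i]]_m :=
  h_d k *: h_r j - h_d j *: h_r k.

Definition cross_cov : 'M[R[i]]_m :=
  2^-1 *: \sum_(j < K) \sum_(k < K)
    ((P j)%:C * (P k)%:C) *: (cross_vec j k *m (cross_vec j k) ^t*).

Variables (h : 'cV[R[i]]_m) (F : 'M[R[i]]_m).

(* A real number >= 1, kept in R[i] so that sqrtC below is its positive root. *)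
Definition noise_power : R[i] := 1 + (h ^t* *m F *m F ^t* *m h) 0 0.

Definition h_eff (k : 'I_K) : 'cV[R[i]]_2 :=
  \col_(i < 2) if i == 0 then (sqrtC noise_power)^-1 * (h ^t* *m F *m h_r k) 0 0
               else h_d k.

(* The determinant is real, the matrix being Hermitian. *)
Definition sum_rate : R :=
  log2 (complex.Re (\det (1%:M + \sum_(k < K)
    (P k)%:C *: (h_eff k *m (h_eff k) ^t*)))).

(* The trace is real, F (I + relay_cov) F^H being Hermitian. *)
Definition relay_power : R :=
  complex.Re (\tr (F *m (1%:M + relay_cov) *m F ^t*)).

End JointRelaying.

(* Main.v *)
(** Put u = F^H h and r = 1 + |u|^2. Expanding the 2x2 determinant and applying
    Lagrange's identity to the cross terms gives
      det = 1 + s + (u^H R u + u^H W u) / r,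
    so the second bound is the Rayleigh inequality for R + W. The same
    identity gives u^H W u <= s (u^H R u), hence
      det <= (1 + s) (1 + u^H R u / r).
    The power constraint gives |u|^2 + u^H R u <= |h|^2 Pr, and together with
    u^H R u <= lambda_max(R) |u|^2 this bounds u^H R u / r. *)

From mathcomp Require Import ring lra.
Require Import Defs.

Import Order.TTheory GRing.Theory Num.Theory.
Local Open Scope complex_scope.
Local Open Scope ring_scope.
Local Open Scope sesquilinear_scope.

Set Implicit Arguments.
Unset Strict Implicit.
Unset Printing Implicit Defensive.

(** * Hermitian quadratic forms and Gram matrices *)

Section QuadraticForm.
Variables (C : numClosedFieldType) (m : nat).
Implicit Types (A B : 'M[C]_m) (u v : 'cV[C]_m) (a : C).

Definition qform A u : C := (u ^t* *m A *m u) 0 0.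

Lemma qformD A B u : qform (A + B) u = qform A u + qform B u.
Proof. by rewrite /qform mulmxDr mulmxDl mxE. Qed.

Lemma qformZ a A u : qform (a *: A) u = a * qform A u.
Proof. by rewrite /qform -scalemxAr -scalemxAl mxE. Qed.

Lemma qform_sum (I : finType) (A : I -> 'M[C]_m) u :
  qform (\sum_i A i) u = \sum_i qform (A i) u.
Proof. by rewrite /qform mulmx_sumr mulmx_suml summxE. Qed.

Lemma qform_gram n (G : 'M[C]_(m, n)) u :
  qform (G *m G ^t*) u = \sum_j `|(u ^t* *m G) 0 j| ^+ 2.
Proof.
have -> : qform (G *m G ^t*) u = ((u ^t* *m G) *m (u ^t* *m G) ^t*) 0 0.
  by rewrite /qform trmx_mul map_mxM /= trmxCK !mulmxA.
by rewrite mxE; apply: eq_bigr => j _; rewrite !mxE normCK.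
Qed.

Lemma qform_outer v u : qform (v *m v ^t*) u = `|(u ^t* *m v) 0 0| ^+ 2.
Proof. by rewrite qform_gram big_ord1. Qed.

Lemma qform1 u : qform 1%:M u = \sum_i `|u i 0| ^+ 2.
Proof.
rewrite /qform mulmx1 mxE; apply: eq_bigr => i _.
by rewrite !mxE normCK mulrC.
Qed.

Lemma qform1_ge0 u : 0 <= qform 1%:M u.
Proof. by rewrite qform1 sumr_ge0// => i _; rewrite exprn_ge0. Qed.

Lemma mxtrace_gram n (G : 'M[C]_(m, n)) :
  \tr (G *m G ^t*) = \sum_j \sum_i `|G i j| ^+ 2.
Proof.
rewrite exchange_big; apply: eq_bigr => i _; rewrite mxE.
by apply: eq_bigr => j _; rewrite !mxE normCK.
Qed.

Lemma mxtrace_gram_ge0 n (G : 'M[C]_(m, n)) : 0 <= \tr (G *m G ^t*).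
Proof.
rewrite mxtrace_gram sumr_ge0// => j _.
by rewrite sumr_ge0// => i _; rewrite exprn_ge0.
Qed.

(** Cauchy-Schwarz on each column of [G]; the squared column norms add up to the trace. *)
Lemma qform_gram_le_tr n (G : 'M[C]_(m, n)) u :
  qform (G *m G ^t*) u <= qform 1%:M u * \tr (G *m G ^t*).
Proof.
rewrite mxtrace_gram qform_gram mulr_sumr; apply: ler_sum => j _.
(* [dotmx] pairs row vectors, hence the conjugate transposes. *)
have [+ _] := CauchySchwarz (@dotmx C m) (u ^t*) ((col j G) ^t*).
rewrite /= !dotmxE !trmxCK.
have -> : (u ^t* *m col j G) 0 0 = (u ^t* *m G) 0 j.
  by rewrite !mxE; apply: eq_bigr => i _; rewrite !mxE.
rewrite -[X in X *m u]mulmx1 -/(qform 1%:M u).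
suff -> : ((col j G) ^t* *m col j G) 0 0 = \sum_i `|G i j| ^+ 2 by [].
by rewrite mxE; apply: eq_bigr => i _; rewrite !mxE normCK mulrC.
Qed.

End QuadraticForm.

(** * Lagrange's identity and the two-by-two determinant *)

Lemma lagrange_identity (C : numClosedFieldType) (I : finType)
    (p a d : I -> C) :
  (\sum_k p k * `|a k| ^+ 2) * (\sum_k p k * `|d k| ^+ 2)
    - (\sum_k p k * (a k * (d k)^*)) * (\sum_k p k * (d k * (a k)^*))
  = 2^-1 * \sum_j \sum_k p j * p k * `|d k * a j - d j * a k| ^+ 2.
Proof.
pose S (f g : I -> C) := \sum_j \sum_k (p j * f j) * (p k * g k).
have SE f g : (\sum_k p k * f k) * (\sum_k p k * g k) = S f g.
  by rewrite mulr_suml; apply: eq_bigr => j _; rewrite mulr_sumr.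
have SC f g : S f g = S g f by rewrite -SE mulrC SE.
(* The squared modulus expands into four product sums, equal in pairs under the exchange of [j] and
   [k]; this is where the factor 1/2 comes from. *)
have -> : \sum_j \sum_k p j * p k * `|d k * a j - d j * a k| ^+ 2 =
    S (fun k => `|a k| ^+ 2) (fun k => `|d k| ^+ 2)
    + S (fun k => `|d k| ^+ 2) (fun k => `|a k| ^+ 2)
    - S (fun k => a k * (d k)^*) (fun k => d k * (a k)^*)
    - S (fun k => d k * (a k)^*) (fun k => a k * (d k)^*).
  rewrite /S -big_split -!sumrB; apply: eq_bigr => j _ /=.
  rewrite -big_split -!sumrB; apply: eq_bigr => k _ /=.
  by rewrite !normCK !rmorphB !rmorphM /=; ring.
rewrite !SE (SC (fun k => `|d k| ^+ 2)) (SC (fun k => d k * _)).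
by field.
Qed.

(** The sums are left unexpanded so that the quadratic terms form the left side of
    [lagrange_identity]. *)
Lemma det_1_add_sum_outer2 (C : numClosedFieldType) (I : finType)
    (p : I -> C) (x : I -> 'cV[C]_2) :
  \det (1%:M + \sum_k p k *: (x k *m (x k) ^t*)) =
  (1 + \sum_k p k * `|x k 0 0| ^+ 2) * (1 + \sum_k p k * `|x k 1 0| ^+ 2)
    - (\sum_k p k * (x k 0 0 * (x k 1 0)^*))
      * (\sum_k p k * (x k 1 0 * (x k 0 0)^*)).
Proof.
set B := \sum_k _.
have BE i j : B i j = \sum_k p k * (x k i 0 * (x k j 0)^*).
  rewrite summxE; apply: eq_bigr => k _.
  by rewrite !mxE big_ord1 !mxE.
have BD i : B i i = \sum_k p k * `|x k i 0| ^+ 2.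
  by rewrite BE; apply: eq_bigr => k _; rewrite normCK.
rewrite -!BD -!BE (expand_det_row _ 0) big_ord_recl big_ord1
  /cofactor !det_mx11.
rewrite !mxE.
have -> : lift 0 0 = 1 :> 'I_2 by apply: val_inj.
have -> : lift 1 0 = 0 :> 'I_2 by apply: val_inj.
by rewrite /=; ring.
Qed.

(** * The Rayleigh inequality *)

Section LargestEigenvalue.
Variables (R : realType) (m : nat).

Lemma hermitian_sum_outer (I : finType) (p : I -> R) (v : I -> 'cV[R[i]]_m) :
  (\sum_k (p k)%:C *: (v k *m (v k) ^t*)) ^t*
    = \sum_k (p k)%:C *: (v k *m (v k) ^t*).
Proof.
rewrite raddf_sum /= map_mx_sum; apply: eq_bigr => k _.
rewrite linearZ /= map_mxZ trmx_mul map_mxM /= trmxCK.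
by congr (_ *: _); apply: conj_Creal; apply/complex_realP; exists (p k).
Qed.

Lemma qform_sum_outer (I : finType) (p : I -> R) (v : I -> 'cV[R[i]]_m) u :
  qform (\sum_k (p k)%:C *: (v k *m (v k) ^t*)) u
    = \sum_k (p k)%:C * `|(u ^t* *m v k) 0 0| ^+ 2.
Proof.
by rewrite qform_sum; apply: eq_bigr => k _; rewrite qformZ qform_outer.
Qed.

Lemma qform_sum_outer_ge0 (I : finType) (p : I -> R) (v : I -> 'cV[R[i]]_m) u :
  (forall k, 0 <= p k) ->
  0 <= qform (\sum_k (p k)%:C *: (v k *m (v k) ^t*)) u.
Proof.
move=> p0; rewrite qform_sum_outer sumr_ge0// => k _.
by rewrite mulr_ge0 ?ler0c ?exprn_ge0.
Qed.

Hypothesis m_gt0 : (0 < m)%N.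

(** In the coordinates [Q *m u] of a unitary diagonalization, the form is a sum of squared moduli
    weighted by eigenvalues, and [qform 1%:M] keeps its value. *)
Lemma qform_le_lambda_max (A : 'M[R[i]]_m) u :
  A ^t* = A -> qform A u <= (lambda_max A)%:C * qform 1%:M u.
Proof using m_gt0.
move=> hermA.
have normalA : A \is normalmx by apply/normalmxP; rewrite hermA.
set Q := spectralmx A; set D := spectral_diag A.
have Qu : Q \is unitarymx := spectral_unitarymx A.
have AE : A = Q ^t* *m diag_mx D *m Q.
  by rewrite -(invmx_unitary Qu); exact: (orthomx_spectralP normalA).
have QQ : Q ^t* *m Q = 1%:M.
  by rewrite -(invmx_unitary Qu) mulVmx// unitarymx_unit.
have QA : Q *m A = diag_mx D *m Q.
  by rewrite AE !mulmxA (unitarymxP Qu) mul1mx.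
have eigD i : eigenvalue A (D 0 i).
  apply/eigenvalueP; exists (row i Q).
    by rewrite -row_mul QA; apply/rowP => j; rewrite mul_diag_mx !mxE.
  (* A zero row would make the diagonal entry of [Q *m Q ^t*] equal to 0 instead of 1. *)
  apply/eqP => rowQ0; move/unitarymxP/matrixP/(_ i i): Qu.
  have -> : (Q *m Q ^t*) i i = (row i Q *m Q ^t*) 0 i by rewrite -row_mul [RHS]mxE.
  by rewrite rowQ0 mul0mx !mxE eqxx => /esym/eqP; rewrite oner_eq0.
have qQ (B : 'M[R[i]]_m) : qform (Q ^t* *m B *m Q) u = qform B (Q *m u).
  by rewrite /qform trmx_mul map_mxM /= !mulmxA.
rewrite [X in qform X u]AE -[1%:M]QQ -[Q ^t* in X in _ <= X]mulmx1 !qQ.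
rewrite qform1 mulr_sumr /qform mul_mx_diag mxE; apply: ler_sum => i _.
rewrite !mxE mulrAC mulrC normCK [X in _ <= _ * X]mulrC ler_wpM2r//.
  by rewrite mulrC -normCK exprn_ge0.
exact: eigenvalue_le_lambda_max.
Qed.

Lemma lambda_max_ge0 (A : 'M[R[i]]_m) :
  A ^t* = A -> (forall u, 0 <= qform A u) -> 0 <= lambda_max A.
Proof using m_gt0.
(* Any nonzero test vector would do; this one has squared norm [m]. *)
move=> hermA A_ge0; pose u : 'cV[R[i]]_m := const_mx 1.
have u_gt0 : 0 < qform 1%:M u.
  rewrite qform1 (eq_bigr (fun=> 1)) => [|i _]; last by rewrite mxE normr1 expr1n.
  by rewrite sumr_const card_ord ltr0n.
have := le_trans (A_ge0 u) (qform_le_lambda_max u hermA).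
by rewrite pmulr_lge0// ler0c.
Qed.

End LargestEigenvalue.

(** * Real inequalities for the final estimates *)

Lemma log2_le (R : realType) (x y : R) : 0 < x -> x <= y -> log2 x <= log2 y.
Proof.
move=> x0 xy; rewrite ler_pM2r ?invr_gt0 ?ln_gt0 ?ltr1n//.
by rewrite ler_ln// posrE (lt_le_trans x0).
Qed.

(* [y / (1 + x)] is the effective relay SNR; on the region [y <= l x],
   [x + y <= N] it is largest at the vertex [x = N / (1 + l)], [y = l x]. *)
Lemma snr_le_vertex (R : realFieldType) (x y l N : R) :
  0 <= x -> 0 <= l -> 0 <= N -> y <= l * x -> x + y <= N ->
  y / (1 + x) <= l * N / (1 + N + l).
Proof.
move=> x0 l0 N0 ylx xyN; rewrite ler_pdivrMr ?ltr_pwDl// mulrAC.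
rewrite ler_pdivlMr -?addrA ?ltr_pwDl ?addr_ge0//.
(* With denominators cleared, right side minus left side is [l * (N - x - y) + N * (l * x - y) + (l
   * x - y)]. *)
have := mulr_ge0 l0 (_ : 0 <= N - x - y).
have := mulr_ge0 N0 (_ : 0 <= l * x - y).
by move=> /(_ ltac:(lra)) ? /(_ ltac:(lra)) ?; lra.
Qed.

(** * The determinant and the power constraint of the relay channel *)

Section JointRelaying.
Variables (R : realType) (K m : nat).
Variables (h_r : 'I_K -> 'cV[R[i]]_m) (h_d : 'I_K -> R[i]) (P : 'I_K -> R).
Variables (h : 'cV[R[i]]_m) (F : 'M[R[i]]_m).

Local Notation s := (direct_snr h_d P).
Local Notation RR := (relay_cov h_r P).
Local Notation W := (cross_cov h_r h_d P).
Local Notation u := (F ^t* *m h).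

Lemma direct_snrE : s%:C = \sum_k (P k)%:C * `|h_d k| ^+ 2.
Proof.
rewrite /direct_snr rmorph_sum; apply: eq_bigr => k _.
by rewrite rmorphM rmorphXn mulrC.
Qed.

(** Indexing by pairs makes [W] a single weighted sum of outer products, so that the [sum_outer]
    lemmas apply to it as they do to [RR]. *)
Lemma cross_covE : W = \sum_(jk : 'I_K * 'I_K)
  (2^-1 * (P jk.1 * P jk.2))%:C *:
    (cross_vec h_r h_d jk.1 jk.2 *m (cross_vec h_r h_d jk.1 jk.2) ^t*).
Proof.
rewrite /cross_cov pair_bigA scaler_sumr; apply: eq_bigr => jk _.
by rewrite scalerA !rmorphM fmorphV rmorph_nat.
Qed.

Lemma cross_cov_hermitian : W ^t* = W.
Proof. by rewrite cross_covE hermitian_sum_outer. Qed.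

Lemma relay_cov_hermitian : RR ^t* = RR.
Proof. exact: hermitian_sum_outer. Qed.

Lemma adj_mul_F : h ^t* *m F = u ^t*.
Proof. by rewrite trmx_mul map_mxM /= trmxCK. Qed.

Lemma noise_powerE : noise_power h F = 1 + qform 1%:M u.
Proof. by rewrite /noise_power /qform mulmx1 -adj_mul_F !mulmxA. Qed.

Let a k := (u ^t* *m h_r k) 0 0.

Lemma qform_relay_cov : qform RR u = \sum_k (P k)%:C * `|a k| ^+ 2.
Proof. exact: qform_sum_outer. Qed.

(** Pairing [u] with [cross_vec j k] gives [h_d k * a j - h_d j * a k], the difference in
    [lagrange_identity]. *)
Lemma qform_cross_cov : qform W u =
  qform RR u * s%:C - (\sum_k (P k)%:C * (a k * (h_d k)^*))
                      * (\sum_k (P k)%:C * (h_d k * (a k)^*)).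
Proof.
rewrite direct_snrE qform_relay_cov lagrange_identity cross_covE.
rewrite qform_sum_outer pair_bigA mulr_sumr; apply: eq_bigr => jk _.
have -> : (u ^t* *m cross_vec h_r h_d jk.1 jk.2) 0 0
    = h_d jk.2 * a jk.1 - h_d jk.1 * a jk.2.
  by rewrite mulmxBr -!scalemxAr /a !mxE.
by rewrite !rmorphM fmorphV rmorph_nat -!mulrA.
Qed.

Lemma det_h_eff :
  \det (1%:M + \sum_(k < K)
      (P k)%:C *: (h_eff h_r h_d h F k *m (h_eff h_r h_d h F k) ^t*))
  = 1 + s%:C + (qform RR u + qform W u) / noise_power h F.
Proof.
have r_ge0 : 0 <= noise_power h F by rewrite noise_powerE addr_ge0 ?qform1_ge0.
(* Being nonnegative, [c] is its own conjugate. It enters the relay diagonal entry twice and each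
   off-diagonal entry once, so both quadratic products carry [c * c], the inverse noise power. *)
set c := (sqrtC (noise_power h F))^-1.
have c_ge0 : 0 <= c by rewrite invr_ge0 sqrtC_ge0.
have cc : c * c = (noise_power h F)^-1 by rewrite -expr2 exprVn sqrtCK.
have x0 k : h_eff h_r h_d h F k 0 0 = c * a k by rewrite mxE /= adj_mul_F.
have x1 k : h_eff h_r h_d h F k 1 0 = h_d k by rewrite mxE.
rewrite det_1_add_sum_outer2.
have -> : \sum_k (P k)%:C * `|h_eff h_r h_d h F k 0 0| ^+ 2 = c * c * qform RR u.
  rewrite qform_relay_cov mulr_sumr; apply: eq_bigr => k _.
  by rewrite x0 normrM (ger0_norm c_ge0); ring.
have -> : \sum_k (P k)%:C * `|h_eff h_r h_d h F k 1 0| ^+ 2 = s%:C.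
  by rewrite direct_snrE; apply: eq_bigr => k _; rewrite x1.
have -> : \sum_k (P k)%:C * (h_eff h_r h_d h F k 0 0 * (h_eff h_r h_d h F k 1 0)^*)
    = c * \sum_k (P k)%:C * (a k * (h_d k)^*).
  by rewrite mulr_sumr; apply: eq_bigr => k _; rewrite x0 x1; ring.
have -> : \sum_k (P k)%:C * (h_eff h_r h_d h F k 1 0 * (h_eff h_r h_d h F k 0 0)^*)
    = c * \sum_k (P k)%:C * (h_d k * (a k)^*).
  rewrite mulr_sumr; apply: eq_bigr => k _.
  by rewrite x0 x1 rmorphM /= (conj_Creal (ger0_real c_ge0)); ring.
by rewrite qform_cross_cov -cc; ring.
Qed.

Hypothesis P_ge0 : forall k, 0 <= P k.

Lemma direct_snr_ge0 : 0 <= s.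
Proof using P_ge0.
rewrite -ler0c direct_snrE sumr_ge0// => k _.
by rewrite mulr_ge0 ?ler0c ?exprn_ge0.
Qed.

Lemma qform_relay_cov_ge0 v : 0 <= qform RR v.
Proof using P_ge0. exact: qform_sum_outer_ge0. Qed.

Lemma qform_cross_cov_ge0 v : 0 <= qform W v.
Proof using P_ge0.
by rewrite cross_covE qform_sum_outer_ge0// => jk; rewrite !mulr_ge0 ?invr_ge0.
Qed.

Lemma qform_cross_cov_le : qform W u <= qform RR u * s%:C.
Proof using P_ge0.
rewrite qform_cross_cov gerBl.
(* Since the powers are real, the two cross sums are conjugate and the subtracted product is a
   squared modulus. *)
set b := \sum_k _; suff -> : \sum_k (P k)%:C * (h_d k * (a k)^*) = b^*.
  by rewrite -normCK exprn_ge0.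
rewrite /b rmorph_sum; apply: eq_bigr => k _; rewrite !rmorphM /= conjCK.
have /conj_Creal -> : (P k)%:C \is Num.real by rewrite ger0_real ?ler0c.
by rewrite [h_d k * _]mulrC.
Qed.

Lemma norm2E : (norm2 h ^+ 2)%:C = qform 1%:M h.
Proof.
rewrite qform1 sqr_sqrtr; last by rewrite sumr_ge0// => k _; rewrite sqr_ge0.
rewrite rmorph_sum; apply: eq_bigr => k _.
by rewrite rmorphXn.
Qed.

(** The left side is the form of [T] at [h]. As [T] is a nonnegative combination of Gram matrices,
    [qform_gram_le_tr] bounds it by the squared norm of [h] times the trace. *)
Lemma qform_relay_power (Pr : R) : relay_power h_r P F <= Pr ->
  qform 1%:M u + qform RR u <= (norm2 h ^+ 2 * Pr)%:C.
Proof using P_ge0.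
set T := F *m (1%:M + RR) *m F ^t*.
have TE : T = F *m F ^t* + \sum_k (P k)%:C *: ((F *m h_r k) *m (F *m h_r k) ^t*).
  rewrite /T mulmxDr mulmxDl mulmx1 mulmx_sumr mulmx_suml; congr (_ + _).
  apply: eq_bigr => k _.
  by rewrite -scalemxAr -scalemxAl trmx_mul map_mxM /= !mulmxA.
have qT : qform 1%:M u + qform RR u = qform T h.
  by rewrite -qformD /qform -adj_mul_F /T !mulmxA.
have T_ge0 : 0 <= \tr T.
  rewrite TE mxtraceD addr_ge0 ?mxtrace_gram_ge0// raddf_sum sumr_ge0// => k _.
  by rewrite /= mxtraceZ mulr_ge0 ?ler0c ?mxtrace_gram_ge0.
have qT_le : qform T h <= qform 1%:M h * \tr T.
  rewrite TE qformD mxtraceD mulrDr lerD ?qform_gram_le_tr//.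
  rewrite raddf_sum /= qform_sum mulr_sumr; apply: ler_sum => k _.
  rewrite qformZ mxtraceZ mulrCA ler_wpM2l ?ler0c//.
  exact: qform_gram_le_tr.
move=> powF; rewrite qT (le_trans qT_le)// rmorphM /= norm2E.
(* The constraint bounds only the real part of the trace, which is the whole trace because [\tr T]
   is nonnegative. *)
rewrite ler_wpM2l ?qform1_ge0// -(RRe_real (ger0_real T_ge0)).
by rewrite lecR.
Qed.

End JointRelaying.

Theorem mainTheorem2 (R : realType) (K m : nat)
    (K_gt0 : (0 < K)%N) (m_gt0 : (0 < m)%N)
    (h_r : 'I_K -> 'cV[complex R]_m) (h_d : 'I_K -> complex R)
    (P : 'I_K -> R) (P_ge0 : forall k, 0 <= P k)
    (h : 'cV[complex R]_m) (Pr : R) (Pr_gt0 : 0 < Pr)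
    (F : 'M[complex R]_m) (F_power : relay_power h_r P F <= Pr) :
  let s := direct_snr h_d P in
  let RR := relay_cov h_r P in
  let W := cross_cov h_r h_d P in
  sum_rate h_r h_d P h F
    <= log2 ((1 + s) * (1 + lambda_max RR * norm2 h ^+ 2 * Pr
                            / (1 + norm2 h ^+ 2 * Pr + lambda_max RR)))
  /\
  sum_rate h_r h_d P h F <= log2 (1 + s + lambda_max (RR + W)).
Proof.
move=> s RR W; rewrite /sum_rate det_h_eff -/s -/RR -/W noise_powerE.
set u := F ^t* *m h.
have RR_herm : RR ^t* = RR := relay_cov_hermitian h_r P.
have RRW_herm : (RR + W) ^t* = RR + W.
  by rewrite linearD map_mxD RR_herm cross_cov_hermitian.
have s0 : 0 <= s := direct_snr_ge0 h_d P_ge0.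
have RR0 v : 0 <= qform RR v := qform_relay_cov_ge0 h_r P_ge0 v.
have W0 v : 0 <= qform W v := qform_cross_cov_ge0 h_r h_d P_ge0 v.
have l0 : 0 <= lambda_max RR by apply: lambda_max_ge0.
have l'0 : 0 <= lambda_max (RR + W).
  by apply: (lambda_max_ge0 m_gt0 RRW_herm) => v; rewrite qformD addr_ge0.
have N0 : 0 <= norm2 h ^+ 2 * Pr by rewrite mulr_ge0 ?sqr_ge0 ?ltW.
have := qform_cross_cov_le h_r h_d h F P_ge0.
have := qform_relay_power h P_ge0 F_power.
have := qform_le_lambda_max m_gt0 u RRW_herm.
have := qform_le_lambda_max m_gt0 u RR_herm.
rewrite qformD -/s -/RR -/W -/u.
move: (W0 u) (RR0 u) (qform1_ge0 u).
(* The three forms are nonnegative in [R[i]], hence embedded reals [x], [y], [z]; from here the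
   argument takes place in [R]. *)
have toR (c : R[i]) : 0 <= c -> exists r : R, c = r%:C.
  by move=> /ger0_real/complex_realP.
move=> z0 y0 x0.
have [[z zE] [y yE] [x xE]] := And3 (toR _ z0) (toR _ y0) (toR _ x0).
rewrite {toR}zE yE xE !ler0c in z0 y0 x0 *.
have -> : 1 + s%:C + (y%:C + z%:C) / (1 + x%:C)
    = (1 + s + (y + z) / (1 + x))%:C.
  by rewrite !rmorphD rmorphM fmorphV !rmorphD rmorph1.
have toCM (p q : R) : p%:C * q%:C = (p * q)%:C by rewrite rmorphM.
have toCD (p q : R) : p%:C + q%:C = (p + q)%:C by rewrite rmorphD.
move=> ylx yzlx xyN zsy.
rewrite toCM lecR in ylx.
rewrite toCD toCM lecR in yzlx.
rewrite toCD lecR in xyN.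
rewrite toCM lecR in zsy.
rewrite [complex.Re _]/=.
have x1 : 0 < 1 + x by rewrite ltr_pwDl.
have det0 : 0 < 1 + s + (y + z) / (1 + x).
  by rewrite -addrA ltr_pwDl// addr_ge0// divr_ge0 ?addr_ge0// ltW.
split; apply: log2_le => //.
  (* The intermediate value arises by replacing [z] with its bound [y * s], which makes the factor
     [1 + s] split off. *)
  apply: (@le_trans _ _ ((1 + s) * (1 + y / (1 + x)))).
    have -> : (1 + s) * (1 + y / (1 + x)) = 1 + s + (y + y * s) / (1 + x).
      by field; rewrite gt_eqF.
    by rewrite lerD2l ler_pM2r ?invr_gt0// lerD2l.
  rewrite ler_pM2l ?ltr_pwDl// lerD2l -[lambda_max RR * _ * Pr]mulrA.
  exact: (snr_le_vertex x0 l0 N0 ylx xyN).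
(* The Rayleigh bound has [x] where [1 + x] is wanted; nonnegativity of the eigenvalue closes the
   gap. *)
rewrite lerD2l ler_pdivrMr// (le_trans yzlx)//.
by rewrite ler_wpM2l// lerDr.
Qed.
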